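(* Let $(R_1,\mathcal L_1)$ and $(R_2,\mathcal L_2)$ be sets with a language. Let $d:R_1\to R_2$ be an injective map such that: (1) for every constant $c\in\mathcal L_1$, the element $d(c)$ can be defined by $\mathcal L_2$, i.e. $\{d(c)\}\subset R_2$ is a Diophantine set; (2) for every function $f:R_1^k\to R_1$ of $\mathcal L_1$, the set $\{(d(x_1),\ldots,d(x_k),d(f(x_1,\ldots,x_k)))\mid (x_1,\ldots,x_k)\in R_1^k\}\subset R_2^{k+1}$ is Diophantine; (3) for every relation $S\subset R_1^k$ of $\mathcal L_1$, the set $d(S)\subset R_2^k$ is Diophantine; (4) the set $d(R_1)\subset R_2$ is Diophantine. Then $d$ is a Diophantine map.
   Context: A ''set with a language'' $(R,\mathcal L)$ is a set $R$ together with a language $\mathcal L$ (constants, function symbols, relation symbols) with an interpretation in $R$; every language contains a constant $0$ and the equality relation $=$. Symbols are identified with their interpretations. A term of $\mathcal L$ is built from constants of $\mathcal L$ and variables using functions of $\mathcal L$. A basic formula is one of the form $(t_1,\ldots,t_k)\in R'$ with $R'\in\mathcal L$ a $k$-ary relation (possibly equality) and $t_i$ terms of $\mathcal L$. A set $S\subset R^k$ is Diophantine (with respect to $\mathcal L$) if there are basic formulas $f_1,\ldots,f_r$ with $S=\{(x_1,\ldots,x_k)\in R^k\mid \exists y_1,\ldots,y_l\in R\ (f_1\wedge\cdots\wedge f_r)\}$. For a map $d:R_1\to R_2$ and $S\subset R_1^k$, $d(S)=\{(d(x_1),\ldots,d(x_k))\mid (x_1,\ldots,x_k)\in S\}$.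 A map $d:R_1\to R_2$ is a Diophantine map if for all $k$ and all Diophantine sets $S\subset R_1^k$ the set $d(S)\subset R_2^k$ is Diophantine. *)

(* Defs.v *)
From mathcomp Require Import all_boot.
From mathcomp Require Import boolp classical_sets.

Set Implicit Arguments.
Unset Strict Implicit.
Unset Printing Implicit Defensive.

Local Open Scope classical_set_scope.

(* A language together with its interpretation in R: function and relation
   symbols are indexed by their arity. The constant zero is not required to
   satisfy any axiom; the symbol eqsym has to be interpreted as equality. *)
Record language (R : Type) := Language {
  const_sym : Type;
  fun_sym : nat -> Type;
  rel_sym : nat -> Type;
  const_val : const_sym -> R;
  fun_val : forall k : nat, fun_sym k -> k.-tuple R -> R;
  rel_val : forall k : nat, rel_sym k -> set (k.-tuple R);
  zero : const_sym;
  eqsym : rel_sym 2;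
  eqsymP : forall a b : R, rel_val eqsym [tuple a; b] <-> a = b
}.

Arguments const_val {R L} c : rename.
Arguments fun_val {R L k} f x : rename.
Arguments rel_val {R L k} P x : rename.

Section Syntax.
Variables (R : Type) (L : language R) (V : Type).

Inductive term : Type :=
| Var (v : V)
| Const (c : const_sym L)
| App (k : nat) (f : fun_sym L k) (args : 'I_k -> term).

Inductive basic_formula : Type :=
| Basic (k : nat) (P : rel_sym L k) (args : 'I_k -> term).

Fixpoint eval (e : V -> R) (t : term) : R :=
  match t with
  | Var v => e v
  | Const c => const_val c
  | App _ f args => fun_val f (mktuple (fun i => eval e (args i)))
  end.

Definition holds (e : V -> R) (phi : basic_formula) : Prop :=
  match phi with
  | Basic _ P args => rel_val P (mktuple (fun i => eval e (args i)))
  end.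

End Syntax.

(* The free variables x_i are indexed by inl, the bound ones y_j by inr. *)
Definition valuation (R : Type) (k l : nat) (x : k.-tuple R) (y : l.-tuple R)
    (v : 'I_k + 'I_l) : R :=
  match v with
  | inl i => tnth x i
  | inr j => tnth y j
  end.

Definition diophantine (R : Type) (L : language R) (k : nat)
    (S : set (k.-tuple R)) : Prop :=
  exists (l r : nat) (phi : 'I_r -> basic_formula L ('I_k + 'I_l)%type),
    S = [set x | exists y : l.-tuple R,
                   forall i : 'I_r, holds (valuation x y) (phi i)].

Definition tuple_image (R1 R2 : Type) (d : R1 -> R2) (k : nat)
    (S : set (k.-tuple R1)) : set (k.-tuple R2) :=
  [set map_tuple d x | x in S].

Definition diophantine_map (R1 R2 : Type) (L1 : language R1)
    (L2 : language R2) (d : R1 -> R2) : Prop :=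
  forall (k : nat) (S : set (k.-tuple R1)),
    diophantine L1 S -> diophantine L2 (tuple_image d S).

(* Main.v *)
Require Import Defs.
From mathcomp Require Import all_boot.
From mathcomp Require Import boolp classical_sets.

Set Implicit Arguments.
Unset Strict Implicit.
Unset Printing Implicit Defensive.

Local Open Scope classical_set_scope.

(** Points of [R^V] are functions [V -> R], for an arbitrary finite set [V] of
variables, and a family [C] of subsets of all the [R^V] is called a projective
family when it is stable under substitution of variables, finite intersection
and projection ([projective_family]).  Two facts carry the proof.

The first is that a projective family over [R] that contains the constants, the
graphs of the functions and the relations of a language contains every
Diophantine set ([projective_family_diophantine]): an intermediate variable is
introduced for the value of each subterm, so that by induction the graph of
every term is in the family, hence so is the solution set of every basic
formula.

The second is that the subsets of the [R1^V] whose image under [d] is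
Diophantine for [L2] form a projective family ([projective_family_image]).
The image of a projection is the projection of the image; the image of an
intersection is the intersection of the images because [d] is injective; and,
again by injectivity, the image of a set obtained by substitution is obtained
by the same substitution from the image, once all coordinates are required to
lie in the range of [d], which is a Diophantine condition.

The hypotheses on constants, functions and relations say that this second
family contains the symbols of [L1], so the first fact applies to it. *)

(** The point of [R^(V + W)] with coordinates [x] on [V] and [y] on [W]. *)
Definition glue {R V W : Type} (x : V -> R) (y : W -> R) (v : V + W) : R :=
  match v with inl a => x a | inr b => y b end.

Lemma glueK {R V W : Type} (z : V + W -> R) :
  glue (fun a => z (inl a)) (fun b => z (inr b)) = z.
Proof. by apply: funext; case. Qed.

Lemma comp_glue {R1 R2 V W : Type} (d : R1 -> R2) (x : V -> R1) (y : W -> R1) :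
  d \o glue x y = glue (d \o x) (d \o y).
Proof. by apply: funext; case. Qed.

Lemma valuation_glue {R : Type} {k l : nat} (x : k.-tuple R) (y : l.-tuple R) :
  valuation x y = glue (tnth x) (tnth y).
Proof. by apply: funext; case. Qed.

Lemma mktuple_tnth {T : Type} {n : nat} (t : n.-tuple T) : mktuple (tnth t) = t.
Proof. by apply: eq_from_tnth => i; rewrite tnth_mktuple. Qed.

Lemma tnth_mktupleE {T : Type} {n : nat} (x : 'I_n -> T) : tnth (mktuple x) = x.
Proof. by apply: funext => i; rewrite tnth_mktuple. Qed.

Lemma map_mktuple {T U : Type} {n : nat} (d : T -> U) (x : 'I_n -> T) :
  map_tuple d (mktuple x) = mktuple (d \o x).
Proof. by apply: eq_from_tnth => i; rewrite tnth_map !tnth_mktuple. Qed.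

(** * Projective families *)

(** Stability of a family of subsets of the powers [R^V], with [V] finite, under
the operations that conjunction, substitution of variables and existential
quantification induce on solution sets.  The empty intersection is included,
so that every [R^V] is in the family. *)
Record projective_family {R : Type}
    (C : forall V : finType, set (V -> R) -> Prop) : Prop := ProjectiveFamily {
  pf_subst : forall (V V' : finType) (g : V -> V') (S : set (V -> R)),
    C V S -> C V' [set x : V' -> R | S (x \o g)];
  pf_bigcap : forall (V I : finType) (S : I -> set (V -> R)),
    (forall i, C V (S i)) -> C V [set x : V -> R | forall i, S i x];
  pf_proj : forall (V W : finType) (S : set ((V + W)%type -> R)),
    C (V + W)%type S ->
    C V [set x : V -> R | exists y : W -> R, S (glue x y)] }.

Lemma pf_setI {R : Type} {C : forall V : finType, set (V -> R) -> Prop}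
    (CP : projective_family C) {V : finType} {A B : set (V -> R)} :
  C V A -> C V B -> C V (A `&` B).
Proof.
move=> CA CB.
have -> : A `&` B = [set x | forall b : bool, (if b then A else B) x].
  apply/seteqP; split=> x /=; first by case=> ? ? [].
  by move=> H; split; [exact: (H true) | exact: (H false)].
by apply: (pf_bigcap CP) => -[].
Qed.

Section Generation.
Context {R : Type} {L : language R}.
Context {C : forall V : finType, set (V -> R) -> Prop}.
Arguments C : clear implicits.
Hypothesis CP : projective_family C.
Hypothesis C_const : forall c : const_sym L,
  C 'I_1 [set x | x ord0 = const_val c].
Hypothesis C_fun : forall (k : nat) (f : fun_sym L k),
  C ('I_k + unit)%type
    [set x | x (inr tt) = fun_val f (mktuple (fun i => x (inl i)))].
Hypothesis C_rel : forall (k : nat) (P : rel_sym L k),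
  C 'I_k [set x | rel_val P (mktuple x)].

(** Equality is available because it is one of the relations of the language. *)
Lemma projective_family_eq (V : finType) (a b : V) : C V [set x | x a = x b].
Proof.
have := pf_subst CP (tnth [tuple a; b]) (C_rel (eqsym L)).
congr (C _ _); apply: funext => x; apply: propext.
rewrite /= -(eqsymP L).
suff -> : mktuple (x \o tnth [tuple a; b]) = [tuple x a; x b] by [].
by rewrite -map_mktuple mktuple_tnth; apply: val_inj.
Qed.

(** The graph of a term as a subset of [R^(V + unit)]; the additional coordinate
[inr tt] is its value. *)
Lemma projective_family_term (V : finType) (t : term L V) :
  C (V + unit)%type [set x | x (inr tt) = eval (fun v => x (inl v)) t].
Proof.
elim: t => [v|c|k f args IH] /=.
- exact: projective_family_eq.
- exact: (pf_subst CP (fun=> inr tt) (C_const c)).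
(* The k coordinates added on the right hold the values of the arguments. *)
pose arg (i : 'I_k) (v : V + unit) : (V + unit) + 'I_k :=
  if v is inl a then inl (inl a) else inr i.
pose res (v : 'I_k + unit) : (V + unit) + 'I_k :=
  if v is inl i then inr i else inl (inr tt).
have Cargs := pf_bigcap CP (fun i => pf_subst CP (arg i) (IH i)).
have := pf_proj CP (pf_setI CP Cargs (pf_subst CP res (C_fun f))).
congr (C _ _); apply: funext => x; apply: propext; split=> /=.
  by case=> y [Hy ->]; congr (fun_val f (mktuple _)); apply: funext.
by move=> ->; exists (fun i => eval (fun v => x (inl v)) (args i)).
Qed.

Lemma projective_family_holds (V : finType) (phi : basic_formula L V) :
  C V [set x | holds x phi].
Proof.
case: phi => k P args /=.
pose arg (i : 'I_k) (v : V + unit) : V + 'I_k :=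
  if v is inl a then inl a else inr i.
have Cargs := pf_bigcap CP
  (fun i => pf_subst CP (arg i) (projective_family_term (args i))).
have := pf_proj CP (pf_setI CP Cargs (pf_subst CP inr (C_rel P))).
congr (C _ _); apply: funext => x; apply: propext; split=> /=.
  case=> y [Hy]; congr (rel_val P (mktuple _)).
  by apply: funext => i; apply: Hy.
by move=> Px; exists (fun i => eval x (args i)).
Qed.

Lemma projective_family_diophantine (k : nat) (S : set (k.-tuple R)) :
  diophantine L S -> C 'I_k [set x | S (mktuple x)].
Proof.
case=> l [r [phi ->]].
have := pf_proj CP (pf_bigcap CP (fun i => projective_family_holds (phi i))).
congr (C _ _); apply: funext => x; apply: propext; split=> /= -[y Hy].
  by exists (mktuple y) => i; rewrite valuation_glue !tnth_mktupleE.
by exists (tnth y) => i; rewrite -[x]tnth_mktupleE -valuation_glue.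
Qed.

End Generation.

(** * Diophantine sets with arbitrary finite sets of variables *)

Fixpoint rename {R : Type} {L : language R} {V W : Type} (g : V -> W)
    (t : term L V) : term L W :=
  match t with
  | Var v => Var L (g v)
  | Const c => Const W c
  | App _ f args => App f (fun i => rename g (args i))
  end.

Definition rename_formula {R : Type} {L : language R} {V W : Type} (g : V -> W)
    (phi : basic_formula L V) : basic_formula L W :=
  match phi with Basic _ P args => Basic P (fun i => rename g (args i)) end.

Lemma eval_rename {R : Type} {L : language R} {V W : Type} (g : V -> W)
    (e : W -> R) (t : term L V) : eval e (rename g t) = eval (e \o g) t.
Proof.
elim: t => //= k f args IH.
by congr (fun_val f (mktuple _)); apply: funext.
Qed.

Lemma holds_rename {R : Type} {L : language R} {V W : Type} (g : V -> W)
    (e : W -> R) (phi : basic_formula L V) :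
  holds e (rename_formula g phi) = holds (e \o g) phi.
Proof.
case: phi => k P args /=; congr (rel_val P (mktuple _)).
by apply: funext => i; rewrite eval_rename.
Qed.

(** Diophantine subsets of [R^V]; the bound variables and the basic formulas are
indexed by finite types instead of initial segments of the integers. *)
Definition fin_diophantine {R : Type} (L : language R) (V : finType)
    (S : set (V -> R)) : Prop :=
  exists (W I : finType) (phi : I -> basic_formula L (V + W)%type),
    S = [set x | exists y : W -> R, forall i, holds (glue x y) (phi i)].
Arguments fin_diophantine {R} L V S.

(** Agreement with [diophantine] on [R^k], tuples being read as functions. *)
Lemma diophantineP {R : Type} (L : language R) (k : nat)
    (S : set (k.-tuple R)) :
  diophantine L S <-> fin_diophantine L 'I_k [set x | S (mktuple x)].
Proof.
split=> [[l [r [phi ->]]]|[W [I [phi Sphi]]]].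
  exists 'I_l, 'I_r, phi.
  apply/seteqP; split=> x /= [y Hy].
    by exists (tnth y) => i; rewrite -[x]tnth_mktupleE -valuation_glue.
  by exists (mktuple y) => i; rewrite valuation_glue !tnth_mktupleE.
pose g (v : 'I_k + W) : 'I_k + 'I_#|W| :=
  match v with inl i => inl i | inr w => inr (enum_rank w) end.
exists #|W|, #|I|, (fun i => rename_formula g (phi (enum_val i))).
have SE t : S t = exists y : W -> R, forall i, holds (glue (tnth t) y) (phi i).
  by rewrite -[in LHS](mktuple_tnth t) -[LHS]/([set x | S (mktuple x)] _) Sphi.
apply/seteqP; split=> t /=; rewrite SE => -[y Hy].
  exists (mktuple (fun j => y (enum_val j))) => i; rewrite holds_rename.
  suff -> : valuation t (mktuple (fun j => y (enum_val j))) \o g =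
            glue (tnth t) y by [].
  by apply: funext => -[//|w] /=; rewrite tnth_mktuple enum_rankK.
exists (fun w => tnth y (enum_rank w)) => i.
have := Hy (enum_rank i); rewrite holds_rename enum_rankK.
by congr (holds _ _); apply: funext; case.
Qed.

Lemma projective_family_fin_diophantine {R : Type} (L : language R) :
  projective_family (fin_diophantine L).
Proof.
split.
- move=> V V' g S [W [I [phi ->]]].
  pose h (v : V + W) : V' + W :=
    match v with inl a => inl (g a) | inr w => inr w end.
  exists W, I, (fun i => rename_formula h (phi i)).
  have glue_h x y : glue x y \o h = glue (x \o g) y :> (_ -> R).
    by apply: funext; case.
  apply/seteqP; split=> x /= [y Hy]; exists y => i.
    by rewrite holds_rename glue_h.
  by have := Hy i; rewrite holds_rename glue_h.
- move=> V I S /choice[W /choice[J SWJ]].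
  pose phi i := sval (cid (SWJ i)).
  have Sphi i : S i = [set x | exists y : W i -> R,
      forall j, holds (glue x y) (phi i j)] := svalP (cid (SWJ i)).
  (* The intersection is defined by all the formulas of the S i together, with
     disjoint copies of their bound variables. *)
  pose inc i (v : V + W i) : V + {i : I & W i} :=
    match v with inl a => inl a | inr w => inr (Tagged W w) end.
  exists {i : I & W i}, {i : I & J i},
    (fun p => rename_formula (inc (tag p)) (phi (tag p) (tagged p))).
  have glue_inc i x y : glue x y \o inc i = glue x (fun w => y (Tagged W w))
      :> (_ -> R) by apply: funext; case.
  apply/seteqP; split=> x /=.
    move=> Sx.
    have /all_sig[y Hy] i :
        {y : W i -> R | forall j, holds (glue x y) (phi i j)}.
      by apply: cid; have := Sx i; rewrite Sphi.
    exists (fun p => y (tag p) (tagged p)) => p.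
    by rewrite holds_rename glue_inc.
  case=> y Hy i; rewrite Sphi; exists (fun w => y (Tagged W w)) => j.
  by have := Hy (Tagged J j); rewrite holds_rename glue_inc.
- move=> V W S [W' [I [phi ->]]].
  pose g (v : V + W + W') : V + (W + W') :=
    match v with
    | inl (inl a) => inl a | inl (inr b) => inr (inl b) | inr w => inr (inr w)
    end.
  exists (W + W')%type, I, (fun i => rename_formula g (phi i)).
  have glueA x y z : glue x (glue y z) \o g = glue (glue x y) z :> (_ -> R).
    by apply: funext => -[[]|].
  apply/seteqP; split=> x /=.
    by case=> y [z Hz]; exists (glue y z) => i; rewrite holds_rename glueA.
  case=> y Hy; exists (fun b => y (inl b)), (fun w => y (inr w)) => i.
  by rewrite -glueA glueK -holds_rename.
Qed.

(** * Sets with Diophantine image *)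

Lemma tuple_image_mktuple {R1 R2 : Type} (d : R1 -> R2) (k : nat)
    (S : set (k.-tuple R1)) :
  [set u : 'I_k -> R2 | tuple_image d S (mktuple u)] =
  [set d \o x | x in [set x : 'I_k -> R1 | S (mktuple x)]].
Proof.
apply/seteqP; split=> u /=.
  case=> t St tu; exists (tnth t); rewrite /= ?mktuple_tnth //.
  apply: funext => i; have := congr1 (fun t => tnth t i) tu.
  by rewrite tnth_map tnth_mktuple.
by case=> x Sx <-; exists (mktuple x); rewrite ?map_mktuple.
Qed.

Section Image.
Context {R1 R2 : Type} {L2 : language R2} {d : R1 -> R2}.
Hypothesis d_inj : injective d.
Hypothesis d_range : diophantine L2 [set [tuple d x] | x in [set: R1]].

Let D2 := projective_family_fin_diophantine L2.

Lemma fin_diophantine_range (V : finType) :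
  fin_diophantine L2 V [set u : V -> R2 | exists x : V -> R1, d \o x = u].
Proof.
have Dv (v : V) : fin_diophantine L2 V [set u : V -> R2 | exists a, d a = u v].
  move/diophantineP: d_range => /(pf_subst D2 (fun=> v)).
  congr (fin_diophantine _ _ _); apply: funext => u; apply: propext; split=> /=.
    case=> a _ da; exists a.
    by have := congr1 (fun t => tnth t ord0) da; rewrite tnth_mktuple.
  case=> a da; exists a => //; apply: eq_from_tnth => i.
  by rewrite tnth_mktuple (ord1 i).
have := pf_bigcap D2 Dv.
congr (fin_diophantine _ _ _); apply: funext => u; apply: propext; split=> /=.
  by move=> /choice[x Hx]; exists x; apply: funext.
by case=> x <- v; exists (x v).
Qed.

Lemma projective_family_image :
  projective_family (fun (V : finType) (S : set (V -> R1)) =>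
    fin_diophantine L2 V [set d \o x | x in S]).
Proof.
have compI (V : Type) (x y : V -> R1) : d \o x = d \o y -> x = y.
  by move=> dxy; apply: funext => v; apply: d_inj; exact: (congr1 (@^~ v) dxy).
split.
- move=> V V' g S DS.
  have := pf_setI D2 (pf_subst D2 g DS) (fin_diophantine_range V').
  congr (fin_diophantine _ _ _); apply/seteqP; split=> u /=.
    case=> -[x Sx dx] [x' dx']; exists x' => //=.
    suff -> : x' \o g = x by [].
    by apply: compI; rewrite dx -dx'.
  by case=> x Sx <-; split; [exists (x \o g) | exists x].
- move=> V I S DS.
  (* The condition on the range is needed when I is empty. *)
  have := pf_setI D2 (pf_bigcap D2 DS) (fin_diophantine_range V).
  congr (fin_diophantine _ _ _); apply/seteqP; split=> u /=.
    case=> Su [x dx]; exists x => //= i.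
    by have [x' Sx' dx'] := Su i; rewrite (compI _ x x') // dx dx'.
  by case=> x Sx <-; split=> [i|]; exists x => //; apply: Sx.
- move=> V W S DS.
  have := pf_proj D2 DS.
  congr (fin_diophantine _ _ _); apply/seteqP; split=> u /=.
    case=> w [z Sz]; rewrite -[z]glueK comp_glue => dz.
    exists (fun a => z (inl a)).
      by exists (fun b => z (inr b)); rewrite glueK.
    by apply: funext => a; exact: (congr1 (@^~ (inl a)) dz).
  by case=> x [y Sxy] <-; exists (d \o y), (glue x y); rewrite ?comp_glue.
Qed.

End Image.

Theorem theorem1p4 (R1 R2 : Type) (L1 : language R1) (L2 : language R2)
    (d : R1 -> R2) (d_inj : injective d)
    (d_const : forall c : const_sym L1,
       diophantine L2 [set [tuple d (const_val c)]])
    (d_fun : forall (k : nat) (f : fun_sym L1 k),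
       diophantine L2
         [set rcons_tuple (map_tuple d x) (d (fun_val f x))
            | x in [set: k.-tuple R1]])
    (d_rel : forall (k : nat) (P : rel_sym L1 k),
       diophantine L2 (tuple_image d (rel_val P)))
    (d_range : diophantine L2 [set [tuple d x] | x in [set: R1]]) :
  diophantine_map L1 L2 d.
Proof.
have D2 := projective_family_fin_diophantine L2.
move=> k S DS; apply/diophantineP; rewrite tuple_image_mktuple.
apply: (projective_family_diophantine (projective_family_image d_inj d_range))
  DS => {k S} [c|k f|k P].
- have := d_const c => /diophantineP.
  congr (fin_diophantine _ _ _); apply/seteqP; split=> u /=.
    move=> uc; exists (fun=> const_val c) => //; apply: funext => i /=.
    by have := congr1 (fun t => tnth t i) uc; rewrite tnth_mktuple (ord1 i).
  case=> x xc <-; apply: eq_from_tnth => i.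
  by rewrite tnth_mktuple (ord1 i) /= xc.
(* The graph of f is given on k.+1 coordinates, the value being the last one;
   g relabels the first k coordinates by inl and the last one by inr tt. *)
- pose g (i : 'I_k.+1) : 'I_k + unit :=
    if insub (i : nat) is Some j then inl j else inr tt.
  have rcons_g (T : Type) (u : 'I_k + unit -> T) :
      mktuple (u \o g) =
      rcons_tuple (mktuple (fun i => u (inl i))) (u (inr tt)).
    apply: eq_from_tnth => i; rewrite tnth_mktuple (tnth_nth (u (inr tt))) /=.
    rewrite nth_rcons size_map size_enum_ord /g.
    case: insubP => [j ltik ji|/negbTE ->]; last by case: ifP.
    by rewrite ltik -ji (nth_map j) ?size_enum_ord ?nth_ord_enum // ji.
  have := d_fun k f => /diophantineP/(pf_subst D2 g).
  congr (fin_diophantine _ _ _); apply/seteqP; split=> u /=.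
    case=> t _; rewrite rcons_g => /(congr1 val)/= /rcons_inj[tu fu].
    exists (glue (tnth t) (fun=> fun_val f t)).
      by rewrite /= mktuple_tnth.
    apply: funext => -[i|[]] //=.
    have {}tu : map_tuple d t = mktuple (fun i => u (inl i)) by exact: val_inj.
    by have := congr1 (fun t => tnth t i) tu; rewrite tnth_map tnth_mktuple.
  case=> x xf <-; exists (mktuple (fun i => x (inl i))) => //.
  by rewrite rcons_g /= -xf map_mktuple.
- by rewrite -tuple_image_mktuple; apply/diophantineP.
Qed.
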